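(* Let $\mathcal{W}$ be a set of nonempty sets (domains), and suppose we have a function $\mathrm{Bel}$ defined on all domains in $\mathcal{W}$: for each $W\in\mathcal{W}$ and all $U,V\subseteq W$ with $U\neq\emptyset$, a real number $\mathrm{Bel}_W(V|U)$ is given. Suppose there exist functions $S:\mathbb{R}\to\mathbb{R}$ and $F:\mathbb{R}^2\to\mathbb{R}$ (the same for all domains) such that: (A1) for all $W\in\mathcal{W}$ and $U,V\subseteq W$ with $U\neq\emptyset$, $\mathrm{Bel}_W(W\setminus V|U)=S(\mathrm{Bel}_W(V|U))$; (A2) for all $W\in\mathcal{W}$ and $U,V,V'\subseteq W$ with $V\cap U\neq\emptyset$, $\mathrm{Bel}_W(V\cap V'|U)=F(\mathrm{Bel}_W(V'|V\cap U),\mathrm{Bel}_W(V|U))$; (Par1) $\mathrm{Bel}_W$ takes values in $[0,1]$ for all $W\in\mathcal{W}$; (Par2) $\mathrm{Bel}_W(\emptyset|U)=0$ and $\mathrm{Bel}_W(U|U)=1$ for all $W\in\mathcal{W}$ and all $U\subseteq W$ with $U\neq\emptyset$; (Par3) $S$ is decreasing; (Par4) $F$ is continuous, and is strictly increasing in each coordinate on $(0,1]^2$; (Par5$'$) for all $0\le\alpha,\beta,\gamma\le1$ and $\epsilon>0$ there exist $W\in\mathcal{W}$ and sets $U_1,U_2,U_3,U_4\subseteq W$ such that $U_1\supseteq U_2\supseteq U_3\supseteq U_4$, $U_3\neq\emptyset$, and each of $|\mathrm{Bel}_W(U_4|U_3)-\alpha|$, $|\mathrm{Bel}_W(U_3|U_2)-\beta|$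 and $|\mathrm{Bel}_W(U_2|U_1)-\gamma|$ is less than $\epsilon$. Then $\mathrm{Bel}$ is uniformly isomorphic to a probability measure, in that there exists a function $g:\mathbb{R}\to\mathbb{R}$ such that for all $W\in\mathcal{W}$, the map $U\mapsto g(\mathrm{Bel}_W(U))$ is a probability measure on $W$, and for all $U,V\subseteq W$ with $U\neq\emptyset$, $$g(\mathrm{Bel}_W(V|U))\times g(\mathrm{Bel}_W(U))=g(\mathrm{Bel}_W(V\cap U)).$$
   Context: $\mathrm{Bel}_W(U)$ abbreviates $\mathrm{Bel}_W(U|W)$. A probability measure on $W$ here means a (finitely additive) probability measure defined on all subsets of $W$. The domains in $\mathcal{W}$ may be finite or infinite. *)

(* Defs.v *)
From HB Require Import structures.
From mathcomp Require Import all_boot all_order all_algebra.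
From mathcomp Require Import all_classical all_reals all_analysis.

Set Implicit Arguments.
Unset Strict Implicit.
Unset Printing Implicit Defensive.

Import Order.TTheory GRing.Theory Num.Theory.
Import numFieldNormedType.Exports.

Local Open Scope classical_set_scope.
Local Open Scope ring_scope.

(* Only finite additivity is required, and every subset of W is measurable.
   The domain W is a subset of an ambient type X, so mu is total on set X;
   its values on sets not contained in W are irrelevant. *)
Record is_probability_measure_on (R : realType) (X : Type) (W : set X)
    (mu : set X -> R) : Prop := IsProbabilityMeasureOn {
  prob_ge0 : forall U : set X, U `<=` W -> 0 <= mu U;
  prob_total : mu W = 1;
  prob_additive : forall U V : set X, U `<=` W -> V `<=` W ->
    U `&` V = set0 -> mu (U `|` V) = mu U + mu V }.

(* Main.v *)
(* By density (Par5') and continuity, the identities satisfied by degrees of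
   belief extend to all of [0, 1]: F is associative and cancellative, and S is a
   continuous involution.  Call a, b, c a partition of one when they behave like
   the degrees of belief of three disjoint sets covering the domain, that is,
   a = F(x, w), b = F(S x, w) and c = S w; this notion is symmetric in a, b, c.
   Let h = S h be the degree "one half".  The equations g(F(x, h)) = g(x) / 2
   and g(S x) = 1 - g(x) form a tent-map system with a unique bounded solution
   g.  The defects g(a) + g(b) + g(c) - 1 of additivity on partitions of one, and
   then the defects g(F(x, y)) - g(x) g(y) of multiplicativity, are bounded and
   are each, up to sign, half of another such defect; hence they vanish. *)
Require Import Defs.
From HB Require Import structures.
From mathcomp Require Import all_boot all_order all_algebra.
From mathcomp Require Import all_classical all_reals all_analysis.
From mathcomp Require Import lra ring.

Set Implicit Arguments.
Unset Strict Implicit.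
Unset Printing Implicit Defensive.

Import Order.TTheory GRing.Theory Num.Theory.
Import numFieldNormedType.Exports.

Local Open Scope classical_set_scope.
Local Open Scope ring_scope.

(** * Contracting recursions and geometric bounds *)

(** The right-hand side contracts sup-distances by one half, whatever [u] and [b] are, so the
    iterates from 0 converge geometrically at each point. *)
Lemma tent_fixpoint (R : realType) (T : Type) (u : T -> bool) (b : T -> T) :
  exists g : T -> R, (forall x, 0 <= g x <= 1) /\
    forall x, g x = if u x then g (b x) / 2 else 1 - g (b x) / 2.
Proof.
pose G n : T -> R := iter n (fun g x =>
  if u x then g (b x) / 2 else 1 - g (b x) / 2) (fun=> 0).
have GS n x : G n.+1 x = if u x then G n (b x) / 2 else 1 - G n (b x) / 2.
  by [].
have G01 n x : 0 <= G n x <= 1.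
  elim: n x => [|n IH] x; first by rewrite lexx ler01.
  rewrite GS; have := IH (b x); case: (u x) => ?; lra.
have Gdist n x : `|G n.+1 x - G n x| <= 2^-1 ^+ n.
  elim: n x => [|n IH] x.
    by have := G01 1%N x; rewrite expr0 subr0 => /andP[? ?]; rewrite ger0_norm.
  have {}IH := IH (b x); rewrite GS [G n.+1 x]GS exprS.
  move: IH; rewrite !ler_norml; case: (u x) => ?; lra.
have Gcvg x : cvgn (fun n => G n x).
  rewrite (_ : (fun n => G n x) = series (telescope (fun n => G n x))); last first.
    by rewrite telescopeK; apply/funext => n /=; rewrite subr0.
  apply: normed_cvg.
  apply: (@series_le_cvg _ _ (geometric 1 2^-1)) => [n|n|n|] //=.
  - by rewrite /geometric /= mul1r; exact: Gdist.
  - by apply: is_cvg_geometric_series; rewrite ger0_norm //; lra.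
exists (fun x => limn (fun n => G n x)); split => x.
  apply/andP; split.
    by apply: limr_ge => //; apply: nearW => n; case/andP: (G01 n x).
  by apply: limr_le => //; apply: nearW => n; case/andP: (G01 n x).
rewrite /=; apply/cvg_lim => //.
rewrite -cvg_shiftS /=.
rewrite (_ : (fun n => _) = fun n =>
  if u x then G n (b x) / 2 else 1 - G n (b x) / 2)//.
case: (u x); first exact: cvgMl (Gcvg _).
by apply: cvgB; [exact: cvg_cst | exact: cvgMl (Gcvg _)].
Qed.

Lemma le_halving_eq0 (R : realType) (C x : R) :
  (forall n, `|x| <= C * 2^-1 ^+ n) -> x = 0.
Proof.
move=> xC; apply/eqP; rewrite -normr_le0.
have C0 : (fun n => C * 2^-1 ^+ n) @ \oo --> C * 0.
  by apply: cvgMr; apply: cvg_expr; rewrite ger0_norm //; lra.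
rewrite -(mulr0 C) -(cvg_lim _ C0) //.
by apply: limr_ge; [apply: cvgP C0 | exact: nearW].
Qed.

(** * The calculus of [F] and [S], free of sets *)

(** The interface between the passage from sets to degrees and the construction of [g].
    Commutativity of [F] is not among the laws, so left and right factors are treated separately
    throughout. *)
Record cox_calculus (R : realType) (F : R -> R -> R) (S : R -> R) : Prop :=
  CoxCalculus {
  F_unit : forall x y, 0 <= x <= 1 -> 0 <= y <= 1 -> 0 <= F x y <= 1;
  F_assoc : forall x y z, 0 <= x <= 1 -> 0 <= y <= 1 -> 0 <= z <= 1 ->
    F (F x y) z = F x (F y z);
  F_1x : forall x, 0 <= x <= 1 -> F 1 x = x;
  F_x1 : forall x, 0 <= x <= 1 -> F x 1 = x;
  F_0x : forall x, 0 <= x <= 1 -> F 0 x = 0;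
  F_ler : forall x y, 0 <= x <= 1 -> 0 <= y <= 1 -> F x y <= y;
  F_inj : forall x y z, 0 <= x <= 1 -> 0 <= y <= 1 -> 0 < z <= 1 ->
    F x z = F y z -> x = y;
  F_continuousl : forall y, continuous (fun x => F x y);
  F_continuousr : forall x, continuous (fun y => F x y);
  S_unit : forall x, 0 <= S x <= 1;
  S_invol : forall x, 0 <= x <= 1 -> S (S x) = x;
  S_antitone : forall x y, x <= y -> S y <= S x;
  S_0 : S 0 = 1;
  S_continuous : continuous S;
  (* For sets A, B, C, decreasing, x = Bel(C|B) and w = Bel(B|A), the witness
     is q = Bel(A - B|A - C). *)
  F_rotate : forall x w, 0 <= x <= 1 -> 0 <= w <= 1 ->
    exists q, [/\ 0 <= q <= 1, F q (S (F x w)) = S w &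
                  F (S q) (S (F x w)) = F (S x) w] }.

Section CoxCalculus.
Variables (R : realType) (F : R -> R -> R) (S : R -> R).
Hypothesis FS : cox_calculus F S.
Implicit Types a b c h p q v w x y : R.

Let I01 : 0 <= (0 : R) <= 1. Proof. by rewrite lexx ler01. Qed.
Let I11 : 0 <= (1 : R) <= 1. Proof. by rewrite lexx ler01. Qed.
#[local] Hint Resolve I01 I11 : core.
#[local] Hint Extern 0 (is_true (0 <= S _ <= 1)) => exact: (S_unit FS) : core.
#[local] Hint Extern 1 (is_true (0 <= F _ _ <= 1)) =>
  apply: (F_unit FS) : core.

Lemma F_x0 x : 0 <= x <= 1 -> F x 0 = 0.
Proof.
move=> x01; apply/eqP; rewrite eq_le (F_ler FS) //=.
by have /andP[->] := F_unit FS x01 I01.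
Qed.

Lemma S_1 : S 1 = 0.
Proof. by rewrite -(S_0 FS) (S_invol FS). Qed.

Lemma S_fixpoint : exists h, 0 < h < 1 /\ S h = h.
Proof.
have [||h] := @IVT R (fun x => S x - x) 0 1 0 ler01.
- apply: continuous_subspaceT => x.
  by apply: cvgB; [exact: (S_continuous FS) | exact: cvg_id].
- by rewrite S_1 (S_0 FS) subr0 sub0r ge_min le_max oppr_le0 !ler01 orbT.
- rewrite in_itv /= => /andP[h0 h1] /eqP; rewrite subr_eq0 => /eqP Sh.
exists h; split => //; rewrite !lt_neqAle h0 h1 !andbT; apply/andP; split.
  by apply/eqP => h00; move: Sh; rewrite -h00 (S_0 FS) => /eqP; rewrite oner_eq0.
by apply/eqP => h11; move: Sh; rewrite h11 S_1 => /esym/eqP; rewrite oner_eq0.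
Qed.

(** Division comes from the intermediate value theorem, as [F q y] runs continuously from 0 to
    [y]. *)
Lemma F_divr x y : 0 <= y <= 1 -> 0 <= x <= y ->
  exists2 q, 0 <= q <= 1 & F q y = x.
Proof.
move=> y01 /andP[x0 xy].
have [||q] := @IVT R (fun q => F q y) 0 1 x ler01.
- exact/continuous_subspaceT/(F_continuousl FS).
- by rewrite (F_0x FS) // (F_1x FS) // ge_min le_max x0 xy orbT.
- by rewrite in_itv /= => q01 <-; exists q.
Qed.

Lemma F_divl x y : 0 <= y <= 1 -> 0 <= x <= y ->
  exists2 q, 0 <= q <= 1 & F y q = x.
Proof.
move=> y01 /andP[x0 xy].
have [||q] := @IVT R (fun q => F y q) 0 1 x ler01.
- exact/continuous_subspaceT/(F_continuousr FS).
- by rewrite F_x0 // (F_x1 FS) // ge_min le_max x0 xy orbT.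
- by rewrite in_itv /= => q01 <-; exists q.
Qed.

(* The possible degrees of belief in the three blocks of a partition, the first
   two of which have a union of degree [w]. *)
Definition partition_of_one a b c := exists x w,
  [/\ 0 <= x <= 1, 0 <= w <= 1, a = F x w, b = F (S x) w & c = S w].

Lemma partition_unit a b c : partition_of_one a b c ->
  [/\ 0 <= a <= 1, 0 <= b <= 1 & 0 <= c <= 1].
Proof. by move=> [x [w [x01 w01 -> -> ->]]]; split; auto. Qed.

Lemma partition_factor a b c : partition_of_one a b c ->
  exists x, [/\ 0 <= x <= 1, a = F x (S c) & b = F (S x) (S c)].
Proof.
by move=> [x [w [x01 w01 -> -> ->]]]; exists x; rewrite (S_invol FS).
Qed.

Lemma partition_swap a b c : partition_of_one a b c -> partition_of_one b a c.
Proof.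
by move=> [x [w [x01 w01 -> -> ->]]]; exists (S x), w; rewrite (S_invol FS).
Qed.

(** The witness of [F_rotate] divides the complement of the first block between the other two.
    Together with [partition_swap] this yields every permutation of the blocks. *)
Lemma partition_rev a b c : partition_of_one a b c -> partition_of_one c b a.
Proof.
move=> [x [w [x01 w01 -> -> ->]]].
have [q [q01 qw qb]] := F_rotate FS x01 w01.
by exists q, (S (F x w)); rewrite qw qb (S_invol FS); auto; split; auto.
Qed.

Lemma partition_split x w : 0 <= x <= 1 -> 0 <= w <= 1 ->
  partition_of_one (F x w) (F (S x) w) (S w).
Proof. by move=> *; exists x, w. Qed.

(* If no block exceeds one half, the halves minus the blocks, doubled, form
   another partition: in additive terms
   [(1 - 2 a) + (1 - 2 b) + (1 - 2 c) = 1]. *)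
Lemma partition_reflect h a b c : 0 < h < 1 -> S h = h ->
  0 <= a <= 1 -> 0 <= b <= 1 -> 0 <= c <= 1 ->
  partition_of_one (F a h) (F b h) (F c h) ->
  partition_of_one (S a) (S b) (S c).
Proof.
move=> /andP[h0 h1] Sh a01 b01 c01 abc.
have h01 : 0 <= h <= 1 by rewrite !ltW.
have hP : 0 < h <= 1 by rewrite h0 ltW.
(* Picture blocks A, B, C and a set H of degree [h] that contains B and avoids A. Then [v] is the
   degree of the complement of A, [p] that of H given this complement, [q1] that of C given it, and
   [q] below that of C - H given C. The two parts of C, outside and inside H, are the halves minus A
   and minus B. *)
have [p [p01 hE aE]] := partition_factor
  (partition_rev (partition_split a01 h01)).
rewrite Sh in hE aE.
have [q1 [q101 cE bE]] := partition_factor (partition_rev abc).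
set v := S (F a h) in hE aE cE bE.
have v01 : 0 <= v <= 1 by exact: (S_unit FS).
have vP : 0 < v <= 1.
  have /andP[v0 ->] := v01; rewrite lt_neqAle v0 !andbT.
  apply/eqP => v00; move: h0.
  by rewrite hE -v00 F_x0 ?ltxx.
have pE : F b p = S q1.
  by apply: (F_inj FS _ _ vP); auto; rewrite (F_assoc FS) // -hE.
have [q [q01 SpE bpE]] := partition_factor
  (partition_rev (partition_split b01 p01)).
rewrite pE (S_invol FS) // in SpE bpE.
exists q, c; split => //; apply: (F_inj FS _ _ hP); auto.
  by rewrite aE SpE !(F_assoc FS) //; auto; rewrite cE.
rewrite [in LHS]hE -(F_assoc FS) //; auto.
by rewrite bpE !(F_assoc FS) //; auto; rewrite cE.
Qed.

(** Up to [h] the value of [g] is forced by doubling ([d] below), and above [h] by reflecting with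
    [S] first; [tent_fixpoint] solves this recursion. *)
Lemma halving_function h : 0 < h < 1 -> S h = h ->
  exists g : R -> R, [/\ forall x, 0 <= g x <= 1,
    forall x, 0 <= x <= 1 -> g (F x h) = g x / 2 &
    forall x, 0 <= x <= 1 -> g (S x) = 1 - g x].
Proof.
move=> /andP[h0 h1] Sh.
have h01 : 0 <= h <= 1 by rewrite !ltW.
have hP : 0 < h <= 1 by rewrite h0 ltW.
pose d y := xget 0 [set q | 0 <= q <= 1 /\ F q h = y].
have dF q : 0 <= q <= 1 -> d (F q h) = q.
  move=> q01; apply: xget_unique => // p [p01 pq].
  exact: (F_inj FS p01 q01 hP).
have [g [g01 gE]] := @tent_fixpoint R R (fun x => x <= h)
  (fun x => if x <= h then d x else d (S x)).
have gF x : 0 <= x <= 1 -> g (F x h) = g x / 2.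
  by move=> x01; rewrite gE (F_ler FS) // dF.
have g0 : g 0 = 0.
  by have := gF 0 I01; rewrite (F_0x FS) // => ?; lra.
(* At [h] the recursion uses only the doubling branch, so the reflection law there has to be checked
   through this value. *)
have gh : g h = 2^-1.
  have := gF 1 I11; rewrite (F_1x FS) // => ->; rewrite gE leNgt h1 /= S_1.
  by rewrite -(F_0x FS h01) dF // g0; lra.
have gS x : 0 <= x <= 1 -> x <= h -> g (S x) = 1 - g x.
  move=> x01; rewrite le_eqVlt => /orP[/eqP->|xh]; first by rewrite Sh gh; lra.
  have : h <= S x by rewrite -Sh (S_antitone FS) // ltW.
  rewrite le_eqVlt => /orP[/eqP hSx|hSx].
    by move: xh; rewrite -(S_invol FS x01) -hSx Sh ltxx.
  by rewrite [LHS]gE leNgt hSx /= (S_invol FS) // [in RHS]gE ltW.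
exists g; split => // x x01.
have [|/ltW hx] := leP x h; first exact: gS.
have Sxh : S x <= h by rewrite -Sh (S_antitone FS).
by have := gS (S x) (S_unit FS x) Sxh; rewrite (S_invol FS) // => ->; lra.
Qed.

Section Valuation.
Variables (h : R) (g : R -> R).
Hypotheses (h_lt : 0 < h < 1) (Sh : S h = h).
Hypotheses (g01 : forall x, 0 <= g x <= 1)
  (gF : forall x, 0 <= x <= 1 -> g (F x h) = g x / 2)
  (gS : forall x, 0 <= x <= 1 -> g (S x) = 1 - g x).

Let h01 : 0 <= h <= 1. Proof. by case/andP: h_lt => *; rewrite !ltW. Qed.

(* The defect [g a + g b + g c - 1] halves under rescaling: the partition is
   doubled inside the union of two blocks if that union is at most one half,
   and is reflected by [partition_reflect] if no such union exists. *)
Lemma partition_sum a b c : partition_of_one a b c -> g a + g b + g c = 1.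
Proof.
move=> abc; apply/eqP; rewrite -subr_eq0; apply/eqP.
(* Three values in [0, 1] put the defect between -1 and 2, whence the constant 2. *)
apply: (@le_halving_eq0 _ 2) => n; elim: n a b c abc => [|n IH] a b c abc.
  rewrite expr0; have := (g01 a, g01 b, g01 c).
  by rewrite ler_norml => -[[? ?] ?]; lra.
(* The union [w] of the first two blocks is at most [h], hence of the form [F w' h]; replacing [w]
   by [w'] doubles the defect exactly. *)
have large x y z : partition_of_one x y z -> h <= z ->
    `|g x + g y + g z - 1| <= 2 * 2^-1 ^+ n.+1.
  move=> [t [w [t01 w01 -> -> ->]]] hSw.
  have [|w' w'01 wE] := @F_divr w h h01.
    by have /andP[-> _] := w01; rewrite -(S_invol FS w01) -Sh (S_antitone FS).
  subst w.
  have := IH _ _ _ (partition_split t01 w'01).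
  rewrite -!(F_assoc FS) // !(gF, gS) //; auto.
  by rewrite exprS !ler_norml => ?; lra.
have [hc|/ltW ch] := leP h c; first exact: large.
have [ha|/ltW ah] := leP h a.
  rewrite (_ : g a + g b + g c = g c + g b + g a); last by ring.
  exact: large (partition_rev abc) ha.
have [hb|/ltW bh] := leP h b.
  rewrite (addrAC (g a)); apply: large hb; apply: partition_swap.
  exact/partition_rev/partition_swap.
have [a01 b01 c01] := partition_unit abc.
have [|a' a'01 aE] := @F_divr a h h01; first by rewrite ah andbT; case/andP: a01.
have [|b' b'01 bE] := @F_divr b h h01; first by rewrite bh andbT; case/andP: b01.
have [|c' c'01 cE] := @F_divr c h h01; first by rewrite ch andbT; case/andP: c01.
subst a b c.
(* Reflection multiplies the defect by -2. *)
have := IH _ _ _ (partition_reflect h_lt Sh a'01 b'01 c'01 abc).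
by rewrite !(gF, gS) // exprS !ler_norml => ?; lra.
Qed.

Lemma valuationD x w : 0 <= x <= 1 -> 0 <= w <= 1 ->
  g w = g (F x w) + g (F (S x) w).
Proof.
move=> x01 w01; have := partition_sum (partition_split x01 w01).
by rewrite gS // => ?; lra.
Qed.

(** For [x] at most [h], writing [x = F h t] and reassociating makes the defect half of the one at
    [t]. For larger [x], additivity makes it the negative of the defect at [S x]. *)
Lemma valuationM x y : 0 <= x <= 1 -> 0 <= y <= 1 -> g (F x y) = g x * g y.
Proof.
move=> x01 y01; apply/eqP; rewrite -subr_eq0; apply/eqP.
(* [gF] halves through a right factor [h]; for a left factor, additivity splits [z] into two equal
   parts because [S h = h]. *)
have gFl z : 0 <= z <= 1 -> g (F h z) = g z / 2.
  by move=> z01; have := valuationD h01 z01; rewrite Sh => ?; lra.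
apply: (@le_halving_eq0 _ 1) => n; elim: n x x01 => [|n IH] x x01.
  rewrite expr0 mulr1; have := (g01 x, g01 y, g01 (F x y)) => -[[? ?] ?].
  by rewrite ler_norml; nra.
have small z : 0 <= z <= 1 -> z <= h ->
    `|g (F z y) - g z * g y| <= 1 * 2^-1 ^+ n.+1.
  move=> /andP[z0 _] zh.
  have [|t t01 <-] := @F_divl z h h01; first by rewrite z0.
  rewrite (F_assoc FS) // !gFl //; auto.
  by have := IH t t01; rewrite exprS !ler_norml; lra.
have [|/ltW hx] := leP x h; first exact: small.
have Sxh : S x <= h by rewrite -Sh (S_antitone FS).
have := small _ (S_unit FS x) Sxh.
by rewrite gS // (valuationD x01 y01) !ler_norml; lra.
Qed.

Lemma valuation1 : g 1 = 1.
Proof.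
have g0 : g 0 = 0 by have := gF I01; rewrite (F_0x FS) // => ?; lra.
by rewrite -{1}(S_0 FS) gS // g0 subr0.
Qed.

End Valuation.

Lemma exists_valuation : exists g : R -> R, [/\ forall x, 0 <= g x,
  g 1 = 1,
  forall x y, 0 <= x <= 1 -> 0 <= y <= 1 -> g (F x y) = g x * g y &
  forall x, 0 <= x <= 1 -> g (S x) = 1 - g x].
Proof.
have [h [h_lt Sh]] := S_fixpoint.
have [g [g01 gF gS]] := halving_function h_lt Sh.
exists g; split => //; first by move=> x; case/andP: (g01 x).
  exact: (valuation1 (h := h)).
exact: (valuationM h_lt Sh g01 gF gS).
Qed.

End CoxCalculus.

(** * Continuity and closed conditions *)

(** A jump would skip values, but an involution attains all of [0, 1]. For [d] slightly above or
    below [s x], the point [s d] lies strictly on one side of [x], and [s (s d) = d] bounds [s] on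
    the other side of [s d]. *)
Lemma antitone_involution_continuous (R : realType) (s : R -> R) :
  (forall x y, x <= y -> s y <= s x) -> (forall x, 0 <= s x <= 1) ->
  (forall x, 0 <= x <= 1 -> s (s x) = x) -> continuous s.
Proof.
move=> s_anti s01 sK x; apply/cvgrPdist_lt => e e0.
have s0 : 0 <= s x by case/andP: (s01 x).
have s1 : s x <= 1 by case/andP: (s01 x).
have upper : \forall t \near x, s t < s x + e.
  have [e1|e1] := ltP 1 (s x + e).
    near=> t; apply: le_lt_trans e1; by case/andP: (s01 t).
  have d01 : 0 <= s x + e / 2 <= 1 by lra.
  have ux : s (s x + e / 2) < x.
    by rewrite ltNge; apply/negP => /s_anti; rewrite sK //; lra.
  near=> t; apply: (@le_lt_trans _ _ (s x + e / 2)); last by lra.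
  rewrite -(sK _ d01); apply: s_anti; apply: ltW.
  by near: t; exact: lt_nbhsr.
have lower : \forall t \near x, s x - e < s t.
  have [e1|e1] := ltP (s x - e) 0.
    near=> t; apply: lt_le_trans e1 _; by case/andP: (s01 t).
  have d01 : 0 <= s x - e / 2 <= 1 by lra.
  have ux : x < s (s x - e / 2).
    by rewrite ltNge; apply/negP => /s_anti; rewrite sK //; lra.
  near=> t; apply: (@lt_le_trans _ _ (s x - e / 2)); first by lra.
  rewrite -[X in X <= _](sK _ d01); apply: s_anti; apply: ltW.
  by near: t; exact: lt_nbhsl.
near=> t; rewrite ltr_norml.
have ? : s t < s x + e by near: t.
have ? : s x - e < s t by near: t.
lra.
Unshelve. all: by end_near. Qed.

Lemma closed_equalizer (R : realType) (T : topologicalType) (f g : T -> R) :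
  continuous f -> continuous g -> closed [set t | f t = g t].
Proof.
move=> cf cg.
rewrite (_ : [set t | _] = (fun t => f t - g t) @^-1` [set x | x = 0]).
  apply: preimage_closed (@closed_eq _ _) => t _.
  exact: (cvgB (cf t) (cg t)).
apply/seteqP; split => t /=; first by move=> ->; rewrite subrr.
by move=> /eqP; rewrite subr_eq0 => /eqP.
Qed.

Lemma closed_inequality (R : realType) (T : topologicalType) (f g : T -> R) :
  continuous f -> continuous g -> closed [set t | f t <= g t].
Proof.
move=> cf cg.
rewrite (_ : [set t | _] = (fun t => g t - f t) @^-1` [set x | 0 <= x]).
  apply: preimage_closed (@closed_ge _ _) => t _.
  exact: (cvgB (cg t) (cf t)).
by apply/seteqP; split => t /=; rewrite subr_ge0.
Qed.

(** * From beliefs about sets to laws on the whole unit interval *)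

Section BeliefFunction.
Variables (R : realType) (X : Type) (DD : set (set X)).
Variables (Bel : set X -> set X -> set X -> R) (S : R -> R) (F : R * R -> R).
Hypotheses
  (A1 : forall W U V : set X, DD W -> U `<=` W -> V `<=` W -> U !=set0 ->
    Bel W (W `\` V) U = S (Bel W V U))
  (A2 : forall W U V V' : set X, DD W ->
    U `<=` W -> V `<=` W -> V' `<=` W -> V `&` U !=set0 ->
    Bel W (V `&` V') U = F (Bel W V' (V `&` U), Bel W V U))
  (Par1 : forall W U V : set X, DD W -> U `<=` W -> V `<=` W -> U !=set0 ->
    0 <= Bel W V U <= 1)
  (Par2 : forall W U : set X, DD W -> U `<=` W -> U !=set0 ->
    Bel W set0 U = 0 /\ Bel W U U = 1)
  (Par3 : forall x y : R, x <= y -> S y <= S x)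
  (F_continuous : continuous F)
  (F_increasing1 : forall x x' y : R,
    0 < x <= 1 -> 0 < x' <= 1 -> 0 < y <= 1 -> x < x' -> F (x, y) < F (x', y))
  (Par5' : forall a b c e : R,
    0 <= a <= 1 -> 0 <= b <= 1 -> 0 <= c <= 1 -> 0 < e ->
    exists W U1 U2 U3 U4 : set X,
      [/\ DD W,
          [/\ U1 `<=` W, U2 `<=` U1, U3 `<=` U2 & U4 `<=` U3],
          U3 !=set0 &
          [/\ `|Bel W U4 U3 - a| < e,
              `|Bel W U3 U2 - b| < e &
              `|Bel W U2 U1 - c| < e]]).

Let I01 : 0 <= (0 : R) <= 1. Proof. by rewrite lexx ler01. Qed.
Let I11 : 0 <= (1 : R) <= 1. Proof. by rewrite lexx ler01. Qed.
#[local] Hint Resolve I01 I11 : core.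

(** By [Par5'] the degrees realised by chains of sets are dense in the unit cube, so a closed
    condition need only be checked on chains. *)
Lemma belief_dense (C : set (R * R * R)) : closed C ->
  (forall W U1 U2 U3 U4, DD W -> U1 `<=` W -> U2 `<=` U1 -> U3 `<=` U2 ->
    U4 `<=` U3 -> U3 !=set0 -> C (Bel W U4 U3, Bel W U3 U2, Bel W U2 U1)) ->
  forall a b c, 0 <= a <= 1 -> 0 <= b <= 1 -> 0 <= c <= 1 -> C (a, b, c).
Proof.
move=> clC CBel a b c a01 b01 c01; apply: clC => N.
move=> /nbhs_ballP[e /= e0 eN].
have [W [U1 [U2 [U3 [U4 [DW [U1W U21 U32 U43] U30 [ea eb ec]]]]]]] :=
  Par5' a01 b01 c01 e0.
exists (Bel W U4 U3, Bel W U3 U2, Bel W U2 U1); split; first exact: CBel.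
by apply: eN; split; [split|]; rewrite -ball_normE /ball_ /= distrC.
Qed.

Lemma chain_rule W U V Z : DD W -> U `<=` W -> V `<=` U -> Z `<=` V ->
  V !=set0 -> Bel W Z U = F (Bel W Z V, Bel W V U).
Proof.
move=> DW UW VU ZV V0; have := @A2 W U V Z DW UW.
rewrite (setIidl VU) (setIidr ZV); apply => //.
  exact: subset_trans VU UW.
by apply: subset_trans UW; exact: subset_trans ZV VU.
Qed.

Let fst1_continuous : continuous (fun p : R * R * R => p.1.1).
Proof. by move=> p; apply: cvg_comp; [exact: cvg_fst | exact: cvg_fst]. Qed.
Let snd1_continuous : continuous (fun p : R * R * R => p.1.2).
Proof. by move=> p; apply: cvg_comp; [exact: cvg_fst | exact: cvg_snd]. Qed.
Let snd_continuous : continuous (fun p : R * R * R => p.2).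
Proof. by move=> p; exact: cvg_snd. Qed.

Let F_comp_continuous (T : topologicalType) (f g : T -> R) :
  continuous f -> continuous g -> continuous (fun t => F (f t, g t)).
Proof.
move=> cf cg t; apply: (@continuous_comp _ _ _ (fun t => (f t, g t)) F).
  exact: (cvg_pair (cf t) (cg t)).
exact: F_continuous.
Qed.

Lemma belief_F1x x : 0 <= x <= 1 -> F (1, x) = x.
Proof.
move=> x01; apply: (@belief_dense [set p | F (1, p.1.2) = p.1.2] _ _ 0 x 0) => //.
  apply: closed_equalizer => //; apply: F_comp_continuous => // p.
  exact: cvg_cst.
move=> W U1 U2 U3 U4 DW U1W U21 U32 _ U30 /=.
have U2W := subset_trans U21 U1W.
have U3W := subset_trans U32 U2W.
by rewrite [RHS](chain_rule DW U2W U32 _ U30) // (Par2 DW U3W U30).2.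
Qed.

Lemma belief_Fx1 x : 0 <= x <= 1 -> F (x, 1) = x.
Proof.
move=> x01; apply: (@belief_dense [set p | F (p.1.1, 1) = p.1.1] _ _ x 0 0) => //.
  apply: closed_equalizer => //; apply: F_comp_continuous => // p.
  exact: cvg_cst.
move=> W U1 U2 U3 U4 DW U1W U21 U32 U43 U30 /=.
have U3W := subset_trans U32 (subset_trans U21 U1W).
by rewrite [RHS](chain_rule DW U3W _ U43 U30) // (Par2 DW U3W U30).2.
Qed.

Lemma belief_setI W U V : DD W -> U `<=` W -> V `<=` W -> U !=set0 ->
  Bel W (U `&` V) U = Bel W V U.
Proof.
move=> DW UW VW U0; rewrite (@A2 W U U V) // setIid // (Par2 DW UW U0).2.
by rewrite belief_Fx1 // Par1.
Qed.

Lemma belief_setD W U V : DD W -> U `<=` W -> V `<=` U -> U !=set0 ->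
  Bel W (U `\` V) U = S (Bel W V U).
Proof.
move=> DW UW VU U0; have VW := subset_trans VU UW.
have WVW : W `\` V `<=` W by move=> ? [].
by rewrite -A1 // -[RHS]belief_setI // setIDA (setIidl UW).
Qed.

Lemma belief_S0 : S 0 = 1.
Proof.
have [W [U1 [U2 [U3 [U4 [DW [U1W U21 U32 _] U30 _]]]]]] :=
  Par5' I01 I01 I01 (@ltr01 R).
have U3W := subset_trans U32 (subset_trans U21 U1W).
by rewrite -(Par2 DW U3W U30).1 -belief_setD // setD0 (Par2 DW U3W U30).2.
Qed.

Lemma belief_SK W U V : DD W -> U `<=` W -> V `<=` U -> U !=set0 ->
  S (S (Bel W V U)) = Bel W V U.
Proof.
by move=> DW UW VU U0; rewrite -!belief_setD // setDD setIidr.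
Qed.

Lemma belief_between (a b : R) : 0 <= a -> a < b -> b <= 1 ->
  exists d, [/\ a < d, d < b & S (S d) = d].
Proof.
move=> a0 ab b1.
have m01 : 0 <= (a + b) / 2 <= 1 by lra.
have e0 : 0 < (b - a) / 2 by lra.
have [W [U1 [U2 [U3 [U4 [DW [U1W U21 U32 U43] U30 [+ _ _]]]]]]] :=
  Par5' m01 I01 I01 e0.
have U3W := subset_trans U32 (subset_trans U21 U1W).
rewrite ltr_norml => d; exists (Bel W U4 U3).
by split; [lra|lra|exact: belief_SK].
Qed.

Lemma belief_S1 : S 1 = 0.
Proof.
have [W [U1 [U2 [U3 [U4 [DW [U1W U21 U32 _] U30 _]]]]]] :=
  Par5' I01 I01 I01 (@ltr01 R).
have U3W := subset_trans U32 (subset_trans U21 U1W).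
by rewrite -(Par2 DW U3W U30).2 -belief_setD // setDv (Par2 DW U3W U30).1.
Qed.

Lemma belief_S_unit x : 0 <= x <= 1 -> 0 <= S x <= 1.
Proof.
move=> /andP[x0 x1]; apply/andP; split.
  by rewrite -belief_S1 Par3.
by rewrite -belief_S0 Par3.
Qed.

(** Continuity of [S] is not yet known, so density cannot be used through closed sets. Instead, [S]
    composed with itself is monotone with a dense set of fixed points, and a fixed point strictly
    between [x] and [S (S x)] contradicts monotonicity. *)
Lemma belief_S_invol x : 0 <= x <= 1 -> S (S x) = x.
Proof.
move=> x01; have /andP[s0 s1] := belief_S_unit (belief_S_unit x01).
have /andP[x0 x1] := x01.
apply/eqP; rewrite eq_le; apply/andP; split; rewrite leNgt; apply/negP => lt.
  have [d [xd ds dE]] := belief_between x0 lt s1.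
  by have := Par3 (Par3 (ltW xd)); rewrite dE leNgt ds.
have [d [sd dx dE]] := belief_between s0 lt x1.
by have := Par3 (Par3 (ltW dx)); rewrite dE leNgt sd.
Qed.

(* [S] is constrained on [0, 1] only; outside it may jump. *)
Definition clamped_S (x : R) := S (Num.max 0 (Num.min x 1)).

Lemma clamped_SE x : 0 <= x <= 1 -> clamped_S x = S x.
Proof. by move=> /andP[x0 x1]; rewrite /clamped_S (min_idPl x1) (max_idPr x0). Qed.

Lemma clamped_S_unit x : 0 <= clamped_S x <= 1.
Proof.
by apply: belief_S_unit; rewrite le_max ge_max ge_min lexx ler01 lexx orbT.
Qed.

Lemma clamped_S_antitone x y : x <= y -> clamped_S y <= clamped_S x.
Proof.
by move=> xy; apply: Par3; rewrite le_max2 // le_min2.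
Qed.

Lemma clamped_S_invol x : 0 <= x <= 1 -> clamped_S (clamped_S x) = x.
Proof.
move=> x01; rewrite [LHS]clamped_SE; last exact: clamped_S_unit.
by rewrite clamped_SE // belief_S_invol.
Qed.

Lemma clamped_S_continuous : continuous clamped_S.
Proof.
exact: (antitone_involution_continuous clamped_S_antitone clamped_S_unit
  clamped_S_invol).
Qed.

Lemma belief_F0x x : 0 <= x <= 1 -> F (0, x) = 0.
Proof.
move=> x01; apply: (@belief_dense [set p | F (0, p.1.2) = 0] _ _ 0 x 0) => //.
  apply: closed_equalizer; last by move=> p; exact: cvg_cst.
  by apply: F_comp_continuous => // p; exact: cvg_cst.
move=> W U1 U2 U3 U4 DW U1W U21 U32 _ U30 /=.
have U2W := subset_trans U21 U1W.
have U3W := subset_trans U32 U2W.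
have U20 : U2 !=set0 by case: U30 => t /U32; exists t.
rewrite -[in LHS](Par2 DW U3W U30).1 -(chain_rule DW U2W U32 _ U30) //.
by rewrite (Par2 DW U2W U20).1.
Qed.

Lemma belief_F_unit x y : 0 <= x <= 1 -> 0 <= y <= 1 -> 0 <= F (x, y) <= 1.
Proof.
move=> x01 y01.
apply: (@belief_dense [set p | 0 <= F (p.1.1, p.1.2) <= 1] _ _ x y 0) => //.
  have cF := F_comp_continuous fst1_continuous snd1_continuous.
  have -> : [set p : R * R * R | 0 <= F (p.1.1, p.1.2) <= 1] =
      [set p | 0 <= F (p.1.1, p.1.2)] `&` [set p | F (p.1.1, p.1.2) <= 1].
    by apply/seteqP; split => p /= => [/andP[]|[-> ->]].
  by apply: closedI; apply: closed_inequality => // p; exact: cvg_cst.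
move=> W U1 U2 U3 U4 DW U1W U21 U32 U43 U30 /=.
have U2W := subset_trans U21 U1W.
rewrite -(chain_rule DW U2W U32 U43 U30); apply: Par1 => //.
  by apply: subset_trans U2W; exact: subset_trans U43 U32.
by case: U30 => t /U32; exists t.
Qed.

Lemma belief_F_assoc x y z : 0 <= x <= 1 -> 0 <= y <= 1 -> 0 <= z <= 1 ->
  F (F (x, y), z) = F (x, F (y, z)).
Proof.
apply: (@belief_dense
  [set p | F (F (p.1.1, p.1.2), p.2) = F (p.1.1, F (p.1.2, p.2))]).
  by apply: closed_equalizer; do ?[apply: F_comp_continuous => //].
move=> W U1 U2 U3 U4 DW U1W U21 U32 U43 U30 /=.
have U2W := subset_trans U21 U1W.
have U31 := subset_trans U32 U21.
have U20 : U2 !=set0 by case: U30 => t /U32; exists t.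
rewrite -(chain_rule DW U2W U32 U43 U30) -(chain_rule DW U1W U21 _ U20) //.
  by rewrite -(chain_rule DW U1W U21 U32 U20) -(chain_rule DW U1W U31 U43 U30).
exact: subset_trans U43 U32.
Qed.

(** For positive [y], monotonicity compares [F (x, y)] with [F (1, y) = y]; the case [y = 0] is a
    limit from positive values. *)
Lemma belief_F_ler x y : 0 <= x <= 1 -> 0 <= y <= 1 -> F (x, y) <= y.
Proof.
move=> x01 y01.
have pos t : 0 < t <= 1 -> F (x, t) <= t.
  move=> t01; have t01' : 0 <= t <= 1 by lra.
  have /orP[/eqP ->|xlt1] : (x == 1) || (x < 1) by rewrite -le_eqVlt; lra.
    by rewrite belief_F1x.
  have /orP[/eqP <-|x0] : (0 == x) || (0 < x) by rewrite -le_eqVlt; lra.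
    by rewrite belief_F0x //; lra.
  by rewrite -[leRHS](belief_F1x t01') ltW // F_increasing1 //; lra.
have /orP[/eqP <-|y0] : (0 == y) || (0 < y) by rewrite -le_eqVlt; lra.
  apply: (@closed_inequality R R (fun t => F (x, t)) id) => [|t|N].
  - by apply: F_comp_continuous => t; [exact: cvg_cst | exact: cvg_id].
  - exact: cvg_id.
  move=> /nbhs_ballP[e /= e0 eN]; exists (Num.min (e / 2) 1); split.
    by apply: pos; rewrite lt_min ge_min lexx orbT ltr01 !andbT; lra.
  apply: eN; rewrite -ball_normE /ball_ /= sub0r normrN ger0_norm.
    by rewrite gt_min; apply/orP; left; lra.
  by rewrite le_min ler01 andbT; lra.
by apply: pos; lra.
Qed.

Lemma belief_F_inj x y z : 0 <= x <= 1 -> 0 <= y <= 1 -> 0 < z <= 1 ->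
  F (x, z) = F (y, z) -> x = y.
Proof.
have F_lt u v : 0 <= u <= 1 -> 0 <= v <= 1 -> 0 < z <= 1 ->
    u < v -> F (u, z) < F (v, z).
  move=> u01 v01 z01 uv; have z01' : 0 <= z <= 1 by lra.
  have m01 : 0 <= (u + v) / 2 <= 1 by lra.
  (* Strict monotonicity is assumed only for positive arguments; when [u] is 0, the midpoint is
     positive and its image lies between 0 and [F (v, z)]. *)
  have /orP[/eqP u0|u0] : (0 == u) || (0 < u) by rewrite -le_eqVlt; lra.
    rewrite -u0 belief_F0x //.
    have /andP[m0 _] := belief_F_unit m01 z01'.
    by apply: le_lt_trans m0 _; apply: F_increasing1; lra.
  by apply: F_increasing1; lra.
move=> x01 y01 z01 Fxy; apply/eqP; rewrite eq_le; apply/andP; split.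
  by rewrite leNgt; apply/negP => /(F_lt _ _ y01 x01 z01); rewrite Fxy ltxx.
by rewrite leNgt; apply/negP => /(F_lt _ _ x01 y01 z01); rewrite Fxy ltxx.
Qed.

Lemma belief_rotate_chain W U V Z : DD W -> U `<=` W -> V `<=` U -> Z `<=` V ->
  V !=set0 -> exists q, [/\ 0 <= q <= 1,
    F (q, S (F (Bel W Z V, Bel W V U))) = S (Bel W V U) &
    F (S q, S (F (Bel W Z V, Bel W V U))) = F (S (Bel W Z V), Bel W V U)].
Proof.
move=> DW UW VU ZV V0.
have VW := subset_trans VU UW; have ZU := subset_trans ZV VU.
have U0 : U !=set0 by case: V0 => t /VU; exists t.
rewrite -(chain_rule DW UW VU ZV V0).
(* The witness conditions on [U - Z]. If that is empty, the three sets coincide and [q = 0]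
   serves. *)
have [UZ|UZ0] := eqVneq (U `\` Z) set0.
  have ZUE : Z = U by apply/seteqP; split => //; rewrite -setD_eq0.
  have VE : V = U by apply/seteqP; split => //; rewrite -[X in X `<=` _]ZUE.
  rewrite ZUE VE (Par2 DW UW U0).2 belief_S1.
  by exists 0; rewrite belief_S0 !belief_F0x // belief_F1x.
have {}UZ0 : U `\` Z !=set0 by apply/set0P.
have UZU : U `\` Z `<=` U by move=> ? [].
have UVUZ : U `\` V `<=` U `\` Z by move=> t [Ut Vt]; split => // /ZV.
have VZUZ : V `\` Z `<=` U `\` Z by move=> t [/VU].
have UZW := subset_trans UZU UW.
exists (Bel W (U `\` V) (U `\` Z)); split.
- by apply: Par1 => //; exact: subset_trans UVUZ UZW.
- by rewrite -!belief_setD // -(chain_rule DW UW UZU UVUZ UZ0).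
rewrite -!belief_setD //.
rewrite (_ : _ `\` (U `\` V) = V `\` Z); last first.
  apply/seteqP; split => t /=.
    by move=> [[Ut Zt] UVt]; split => //; apply: contrapT => Vt; apply: UVt.
  by move=> [Vt Zt]; split; [split => //; exact: VU | case].
rewrite -(chain_rule DW UW UZU VZUZ UZ0).
by rewrite -(chain_rule DW UW VU _ V0) // => t [].
Qed.

(* The pairs [(x, w)] admitting such a [q] form the projection of a compact
   set, so the existence of [q] survives the passage to the limit. *)
Lemma belief_rotate x w : 0 <= x <= 1 -> 0 <= w <= 1 ->
  exists q, [/\ 0 <= q <= 1,
    F (q, clamped_S (F (x, w))) = clamped_S w &
    F (clamped_S q, clamped_S (F (x, w))) = F (clamped_S x, w)].
Proof.
move=> x01 w01.
pose s := clamped_S.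
pose E1 := [set p : R * R * R | F (p.2, s (F (p.1.1, p.1.2))) = s p.1.2].
pose E2 := [set p : R * R * R |
  F (s p.2, s (F (p.1.1, p.1.2))) = F (s p.1.1, p.1.2)].
pose I : set R := `[0, 1]%classic.
pose K := (E1 `&` E2) `&` ((I `*` I) `*` I).
have s_comp (f : R * R * R -> R) : continuous f -> continuous (fun p => s (f p)).
  move=> cf p; apply: (@continuous_comp _ _ _ f s); first exact: cf.
  exact: clamped_S_continuous.
have cI : compact I by exact: segment_compact.
have cIII : compact ((I `*` I) `*` I) by do 2?apply: compact_setX.
have closedE : closed (E1 `&` E2).
  apply: closedI; apply: closed_equalizer;
    do ?[apply: F_comp_continuous => // | apply: s_comp => //].
have compactK : compact K.
  apply: (subclosed_compact _ cIII); last by move=> ? [].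
  by apply: closedI => //; apply: compact_closed cIII; exact: norm_hausdorff.
have closedK : closed (fst @` K).
  apply: compact_closed; first exact: norm_hausdorff.
  apply: continuous_compact compactK; apply: continuous_subspaceT => p.
  exact: cvg_fst.
(* The third coordinate of the density triple is padding here: the closed set is the cylinder over
   the projection of [K], in which [q] was the third coordinate. *)
have : (fst @^-1` (fst @` K)) (x, w, 0 : R).
  apply: belief_dense => //; first by apply: preimage_closed => // p _; exact: cvg_fst.
  move=> W U1 U2 U3 U4 DW U1W U21 U32 U43 U30.
  have U2W := subset_trans U21 U1W.
  have U3W := subset_trans U32 U2W.
  have [q [q01 q1 q2]] := belief_rotate_chain DW U2W U32 U43 U30.
  have Z01 : 0 <= Bel W U4 U3 <= 1.
    by apply: Par1 => //; exact: subset_trans U43 U3W.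
  have V01 : 0 <= Bel W U3 U2 <= 1.
    by apply: Par1 => //; case: U30 => t /U32; exists t.
  have F01 := belief_F_unit Z01 V01.
  exists (Bel W U4 U3, Bel W U3 U2, q) => //.
  split; last by rewrite /I; split; [split|]; rewrite /= in_itv.
  by split; rewrite /E1 /E2 /s /= !clamped_SE.
case=> -[[x' w'] q] [[e1 e2] [_ /= q01]] /= [xE wE].
by rewrite -xE -wE; exists q; split.
Qed.

Lemma belief_cox_calculus : cox_calculus (fun x y => F (x, y)) clamped_S.
Proof.
split.
- exact: belief_F_unit.
- exact: belief_F_assoc.
- exact: belief_F1x.
- exact: belief_Fx1.
- exact: belief_F0x.
- exact: belief_F_ler.
- exact: belief_F_inj.
- by move=> y; apply: F_comp_continuous => t; [exact: cvg_id | exact: cvg_cst].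
- by move=> x; apply: F_comp_continuous => t; [exact: cvg_cst | exact: cvg_id].
- exact: clamped_S_unit.
- exact: clamped_S_invol.
- exact: clamped_S_antitone.
- by rewrite clamped_SE // belief_S0.
- exact: clamped_S_continuous.
- exact: belief_rotate.
Qed.

End BeliefFunction.

(* DD is the set of domains; Bel W V U is the belief in V given U in the
   domain W.  It is constrained only for W in DD, U and V subsets of W and U
   nonempty; the unconditional belief in U is Bel W U W. *)
Theorem theorem5 (R : realType) (X : Type) (DD : set (set X))
  (DD_nonempty : forall W : set X, DD W -> W !=set0)
  (Bel : set X -> set X -> set X -> R)
  (S : R -> R) (F : R * R -> R)
  (A1 : forall W U V : set X, DD W -> U `<=` W -> V `<=` W -> U !=set0 ->
    Bel W (W `\` V) U = S (Bel W V U))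
  (A2 : forall W U V V' : set X, DD W ->
    U `<=` W -> V `<=` W -> V' `<=` W -> V `&` U !=set0 ->
    Bel W (V `&` V') U = F (Bel W V' (V `&` U), Bel W V U))
  (Par1 : forall W U V : set X, DD W -> U `<=` W -> V `<=` W -> U !=set0 ->
    0 <= Bel W V U <= 1)
  (Par2 : forall W U : set X, DD W -> U `<=` W -> U !=set0 ->
    Bel W set0 U = 0 /\ Bel W U U = 1)
  (Par3 : forall x y : R, x <= y -> S y <= S x)
  (Par4_continuous : continuous F)
  (Par4_increasing1 : forall x x' y : R,
    0 < x <= 1 -> 0 < x' <= 1 -> 0 < y <= 1 -> x < x' -> F (x, y) < F (x', y))
  (Par4_increasing2 : forall x y y' : R,
    0 < x <= 1 -> 0 < y <= 1 -> 0 < y' <= 1 -> y < y' -> F (x, y) < F (x, y'))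
  (Par5' : forall a b c e : R,
    0 <= a <= 1 -> 0 <= b <= 1 -> 0 <= c <= 1 -> 0 < e ->
    exists W U1 U2 U3 U4 : set X,
      [/\ DD W,
          [/\ U1 `<=` W, U2 `<=` U1, U3 `<=` U2 & U4 `<=` U3],
          U3 !=set0 &
          [/\ `|Bel W U4 U3 - a| < e,
              `|Bel W U3 U2 - b| < e &
              `|Bel W U2 U1 - c| < e]]) :
  exists g : R -> R, forall W : set X, DD W ->
    is_probability_measure_on W (fun U : set X => g (Bel W U W)) /\
    (forall U V : set X, U `<=` W -> V `<=` W -> U !=set0 ->
       g (Bel W V U) * g (Bel W U W) = g (Bel W (V `&` U) W)).
Proof.
have calc := belief_cox_calculus A1 A2 Par1 Par2 Par3 Par4_continuous
  Par4_increasing1 Par5'.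
have [g [g_ge0 g1 gM gS]] := exists_valuation calc.
have chain W U V Z := @chain_rule R X DD Bel F A2 W U V Z.
have setI W U V := @belief_setI R X DD Bel F A2 Par1 Par2 Par4_continuous Par5'
  W U V.
have setD W U V := @belief_setD R X DD Bel S F A1 A2 Par1 Par2 Par4_continuous
  Par5' W U V.
exists g => W DW; have W0 := DD_nonempty W DW.
have gchain U V : U `<=` W -> V `<=` U -> U !=set0 ->
    g (Bel W V W) = g (Bel W V U) * g (Bel W U W).
  move=> UW VU U0; have VW := subset_trans VU UW.
  by rewrite -gM ?Par1 // -(chain W W U V).
have g_empty : g (Bel W set0 W) = 0.
  rewrite (Par2 W W DW _ W0).1 //; have := gS 1.
  by rewrite (S_1 calc) g1 subrr; apply; rewrite ler01 lexx.
split; last first.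
  by move=> U V UW VW U0; rewrite -(setI W U V) // setIC (gchain U (V `&` U)) //.
split => [U UW||U V UW VW UV0].
- exact: g_ge0.
- by rewrite (Par2 W W DW _ W0).2.
(* Additivity is obtained by conditioning on the union, which must be nonempty; inside it [V] is the
   complement of [U], so the law for [S] applies. *)
have [UV|/set0P UV] := eqVneq (U `|` V) set0.
  move: (UV); rewrite setU_eq0 => -[-> ->].
  by rewrite setU0 g_empty addr0.
have UVW : U `|` V `<=` W by rewrite subUset.
have UVU : U `<=` U `|` V by move=> t; left.
have UVV : V `<=` U `|` V by move=> t; right.
have VE : (U `|` V) `\` U = V.
  apply/seteqP; split => [t [[]]|t Vt] //; split; first by right.
  by move=> Ut; have : (U `&` V) t by []; rewrite UV0.
have gV : g (Bel W V (U `|` V)) = 1 - g (Bel W U (U `|` V)).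
  have U01 := Par1 W _ _ DW UVW UW UV.
  by rewrite -(gS _ U01) clamped_SE // -setD // VE.
by rewrite (gchain _ U UVW) // (gchain _ V UVW) // -mulrDl gV addrC subrK mul1r.
Qed.
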